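(* Let $K$ be a field, $S=K[x_1,\dots,x_n]$, and let $I\subset S$ be a nonzero monomial ideal generated in a single degree which has linear relations. Suppose that the linear relation graph $\Gamma$ of $I$ has $r$ vertices and $s$ connected components. Then $$\ell(I)=r-s+1.$$
   Context: $G(I)=\{u_1,\dots,u_m\}$ is the set of minimal monomial generators of $I$. The ideal $I$, generated in a single degree, has linear relations if the first syzygy module of $I$ (the kernel of $\bigoplus_{i=1}^m Se_i\to I$, $e_i\mapsto u_i$) is generated by relations whose coefficients are linear forms; equivalently, it is generated by relations of the form $x_ke_\alpha-x_le_\beta$. The linear relation graph $\Gamma$ of $I$ is the graph with edge set $E(\Gamma)=\{\{i,j\} : i\ne j \text{ and there exist } u_k,u_l\in G(I) \text{ such that } x_iu_k=x_ju_l\}$, and its vertices are exactly the integers that belong to some edge. The analytic spread $\ell(I)$ is the Krull dimension of the fiber ring $\mathcal R(I)/\mathfrak m\mathcal R(I)$, where $\mathcal R(I)$ is the Rees algebra of $I$ and $\mathfrak m=(x_1,\dots,x_n)$. *)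

(* Defs.v *)
From HB Require Import structures.
From mathcomp Require Import all_boot all_order all_algebra.
From mathcomp Require Import ring_quotient boolp.
From mathcomp Require Import mpoly.

Set Implicit Arguments.
Unset Strict Implicit.
Unset Printing Implicit Defensive.

Import GRing.Theory.

Local Open Scope ring_scope.

Section Generated.
Variables (R : nzRingType) (V : lmodType R).

Definition submod_gen (B : V -> Prop) : {pred V} :=
  [pred v | `[< exists s : seq (R * V),
    (forall x, x \in s -> B x.2) /\ v = \sum_(x <- s) x.1 *: x.2 >]].

Lemma submod_genP (B : V -> Prop) v :
  reflect (exists s : seq (R * V),
    (forall x, x \in s -> B x.2) /\ v = \sum_(x <- s) x.1 *: x.2)
    (v \in submod_gen B).
Proof. exact: asboolP. Qed.

Lemma submod_gen0 B : 0 \in submod_gen B.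
Proof. by apply/submod_genP; exists [::]; split=> //; rewrite big_nil. Qed.

Lemma submod_genZD B a u v :
  u \in submod_gen B -> v \in submod_gen B -> a *: u + v \in submod_gen B.
Proof.
move=> /submod_genP[s [Bs ->]] /submod_genP[t [Bt ->]].
apply/submod_genP; exists ([seq (a * x.1, x.2) | x <- s] ++ t); split.
  by move=> x; rewrite mem_cat => /orP[/mapP[y ys ->]|/Bt //]; apply: Bs ys.
rewrite big_cat big_map scaler_sumr; congr (_ + _).
by apply: eq_bigr => x _; rewrite scalerA.
Qed.

Lemma submod_gen_mem B u : B u -> u \in submod_gen B.
Proof.
move=> Bu; apply/submod_genP; exists [:: (1, u)]; split.
  by move=> x; rewrite inE => /eqP->.
by rewrite big_seq1 scale1r.
Qed.

End Generated.

(* The ideal generated by B, as a submodule of the regular module. *)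
Definition ideal_gen (A : comNzRingType) (B : A -> Prop) : {pred A} :=
  @submod_gen A A^o B.

Section IdealGen.
Variable A : comNzRingType.
Implicit Types B C : A -> Prop.

Lemma ideal_gen0 B : 0 \in ideal_gen B.
Proof. exact: (@submod_gen0 A A^o). Qed.

Lemma ideal_genMD B a u v :
  u \in ideal_gen B -> v \in ideal_gen B -> a * u + v \in ideal_gen B.
Proof. exact: (@submod_genZD A A^o). Qed.

Lemma ideal_gen_mem B u : B u -> u \in ideal_gen B.
Proof. exact: (@submod_gen_mem A A^o). Qed.

Lemma ideal_genM B C D u v : (forall b c, B b -> C c -> D (b * c)) ->
  u \in ideal_gen B -> v \in ideal_gen C -> u * v \in ideal_gen D.
Proof.
move=> BCD /(@submod_genP A A^o)[s [Bs ->]] /(@submod_genP A A^o)[t [Ct ->]].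
rewrite [_ * _]mulr_suml big_seq.
elim/big_rec: _ => [|x w xs Dw]; first exact: ideal_gen0.
rewrite /= addrC -[w]mul1r addrC mul1r.
suff: (x.1 *: x.2 : A^o) * (\sum_(y <- t) (y.1 *: y.2 : A^o)) \in ideal_gen D.
  by move=> h; rewrite -[X in X + _]mul1r; apply: ideal_genMD.
rewrite mulr_sumr big_seq.
elim/big_rec: _ => [|y z yt Dz]; first exact: ideal_gen0.
have ->: (x.1 *: x.2 : A^o) * (y.1 *: y.2 : A^o)
         = (x.1 * y.1) * (x.2 * y.2) :> A by exact: mulrACA.
by apply: ideal_genMD => //; apply: ideal_gen_mem; apply: BCD; [apply: Bs|apply: Ct].
Qed.

End IdealGen.

Definition is_ideal (A : comNzRingType) (I : {pred A}) : Prop :=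
  0 \in I /\ forall a, {in I &, forall u v, a * u + v \in I}.

(* idealr_closed includes properness (1 is not in the ideal). *)
Definition prime_ideal (A : comNzRingType) (P : {pred A}) : Prop :=
  idealr_closed P /\ prime_idealr_closed P.

Definition prime_chain (A : comNzRingType) (d : nat)
    (P : 'I_d.+1 -> {pred A}) : Prop :=
  (forall i, prime_ideal (P i)) /\
  (forall i j : 'I_d.+1, (i < j)%N ->
     {subset P i <= P j} /\ ~ {subset P j <= P i}).

(* "dim A = d" for finite d. *)
Definition has_krull_dim (A : comNzRingType) (d : nat) : Prop :=
  (exists P : 'I_d.+1 -> {pred A}, prime_chain P) /\
  (forall (e : nat) (P : 'I_e.+1 -> {pred A}), prime_chain P -> (e <= d)%N).

Section Monomial.
Variables (K : fieldType) (n : nat).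
Local Notation S := {mpoly K[n]}.
Implicit Type I : {pred S}.

Definition monomial_ideal I : Prop :=
  exists M : 'X_{1..n} -> Prop,
    I =i ideal_gen (fun p : S => exists2 u, M u & p = 'X_[u]).

Definition min_gen I (u : 'X_{1..n}) : Prop :=
  'X_[u] \in I /\
  (forall v : 'X_{1..n}, 'X_[v] \in I -> (v <= u)%MM -> v = u).

Definition generated_in_single_degree I : Prop :=
  exists (d : nat) (B : S -> Prop),
    (forall p, B p -> p \is d.-homog) /\ I =i ideal_gen B.

(* Kernel of S^m -> I, e_i |-> u_i. *)
Definition syzygy m (u : m.-tuple 'X_{1..n}) (w : 'rV[S]_m) : Prop :=
  \sum_(i < m) w 0 i * 'X_[tnth u i] = 0.

Definition linear_syzygy m (u : m.-tuple 'X_{1..n}) (w : 'rV[S]_m) : Prop :=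
  syzygy u w /\ (forall i, w 0 i \is 1.-homog).

(* u enumerates the set G(I), which is finite by Dickson's lemma. *)
Definition has_linear_relations I : Prop :=
  exists (m : nat) (u : m.-tuple 'X_{1..n}),
    [/\ uniq u,
        (forall v, v \in u <-> min_gen I v) &
        (forall w, syzygy u w -> w \in submod_gen (linear_syzygy u))].

Definition linear_relation_graph I : rel 'I_n :=
  fun i j => (i != j) && `[< exists u v : 'X_{1..n},
    [/\ min_gen I u, min_gen I v & 'X_i * 'X_[u] = 'X_j * 'X_[v] :> S] >].

Definition graph_vertices (e : rel 'I_n) : {set 'I_n} :=
  [set i | [exists j, e i j]].

Lemma linear_relation_graph_sym I : ssrbool.symmetric (linear_relation_graph I).
Proof.
move=> i j; rewrite /linear_relation_graph eq_sym; congr (_ && _).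
by apply: asbool_equiv_eq; split=> -[u [v [Gu Gv uv]]]; exists v, u.
Qed.

(* Hence no truncation occurs in "#vertices - #components" over nat. *)
Lemma leq_n_comp_vertices (e : rel 'I_n) :
  (n_comp e (graph_vertices e) <= #|graph_vertices e|)%N.
Proof. by apply/subset_leq_card/subsetP => i; rewrite inE => /andP[]. Qed.

Definition ideal_pow I (k : nat) : {pred S} :=
  ideal_gen (fun p => exists2 t : k.-tuple S,
    all (fun q => q \in I) t & p = \prod_(q <- t) q).

Lemma ideal_pow_mul I j k p q :
  p \in ideal_pow I j -> q \in ideal_pow I k -> p * q \in ideal_pow I (j + k).
Proof.
apply: ideal_genM => _ _ [s sI ->] [t tI ->].
by exists [tuple of s ++ t]; [rewrite all_cat sI | rewrite big_cat].
Qed.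

Lemma mem_ideal_pow0 I p : p \in ideal_pow I 0.
Proof.
rewrite -[p]mulr1 -[p * 1]addr0; apply: ideal_genMD; last exact: ideal_gen0.
by apply: ideal_gen_mem; exists [tuple] => //; rewrite big_nil.
Qed.

(* S[It], as a subring of S[t]. *)
Definition rees_pred I : {pred {poly S}} :=
  [pred p : {poly S} | `[< forall k, p`_k \in ideal_pow I k >]].

Lemma rees_predP I (p : {poly S}) :
  reflect (forall k, p`_k \in ideal_pow I k) (p \in rees_pred I).
Proof. exact: asboolP. Qed.

Lemma rees_subring_closed I : subring_closed (rees_pred I).
Proof.
split.
- apply/rees_predP => -[|k]; first exact: mem_ideal_pow0.
  by rewrite coef1 /=; apply: ideal_gen0.
- move=> p q /rees_predP hp /rees_predP hq; apply/rees_predP => k.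
  by rewrite coefB addrC -mulN1r; apply: ideal_genMD.
- move=> p q /rees_predP hp /rees_predP hq; apply/rees_predP => k.
  rewrite coefM; elim/big_rec: _ => [|i r _ hr]; first exact: ideal_gen0.
  have le_ik : (i <= k)%N by rewrite -ltnS.
  have hik : p`_i * q`_(k - i) \in ideal_pow I (i + (k - i)).
    exact: ideal_pow_mul.
  rewrite subnKC // in hik.
  by rewrite -[X in X + _]mul1r; apply: ideal_genMD.
Qed.

HB.instance Definition _ I :=
  GRing.isSubringClosed.Build {poly S} (rees_pred I) (rees_subring_closed I).

Record rees I := Rees { rees_val :> {poly S}; _ : rees_val \in rees_pred I }.

HB.instance Definition _ I := [isSub for @rees_val I].
HB.instance Definition _ I := [Choice of rees I by <:].
HB.instance Definition _ I := [SubChoice_isSubComNzRing of rees I by <:].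

Lemma rees_polyC I (p : S) : p%:P \in rees_pred I.
Proof.
apply/rees_predP => -[|k]; first exact: mem_ideal_pow0.
by rewrite coefC; apply: ideal_gen0.
Qed.

Definition rees_const I (p : S) : rees I := Rees (rees_polyC I p).

(* The extension m R(I) of m = (x_1, ..., x_n) to the Rees algebra. *)
Definition fiber_ideal I : {pred (rees I)} :=
  ideal_gen (fun a => exists i : 'I_n, a = rees_const I 'X_i).

Lemma fiber_ideal_closed I : idealr_closed (@fiber_ideal I).
Proof.
split; first exact: ideal_gen0; last first.
  by move=> a u v hu hv; apply: ideal_genMD.
apply/negP => /(@submod_genP (rees I) (rees I)^o)[s [hs]].
pose f (a : rees I) : K := ((rees_val a)`_0)@_0%MM.
have fD : {morph f : a b / a + b} by move=> a b; rewrite /f /= coefD mcoeffD.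
have f0 : f 0 = 0 by rewrite /f /= coef0 mcoeff0.
move/(congr1 f); rewrite {1}/f /= coef1 mcoeff1 eqxx (big_morph f fD f0).
rewrite big_seq big1 => [/eqP|x /hs[i hx]]; first by rewrite oner_eq0.
have -> : x.1 *: x.2 = x.1 * x.2 :> rees I by [].
rewrite hx /f /= coefMC (rmorphM (mcoeff 0%MM)) /= mcoeffX.
by rewrite mnm1_eq0 mulr0.
Qed.

HB.instance Definition _ I :=
  isIdealr.Build (rees I) (@fiber_ideal I) (fiber_ideal_closed I).

(* R(I) / m R(I). *)
Definition fiber_ring I := {ideal_quot (@fiber_ideal I)}.

HB.instance Definition _ I := GRing.ComNzRing.on (fiber_ring I).

Definition has_analytic_spread I (l : nat) : Prop :=
  has_krull_dim (fiber_ring I) l.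

End Monomial.

(* Main.v *)
From HB Require Import structures.
Require Import Defs.
From mathcomp Require Import all_boot all_order all_algebra mpoly zify.
From mathcomp Require Import ring_quotient boolp.

(** Write F for the fiber ring, u_1, ..., u_m for the minimal generators, all of
    degree d, and Gamma for the linear relation graph. Modulo the maximal ideal
    only the constant term of a coefficient survives, so F is spanned over K by
    the classes of the products of generators u_(a1) ... u_(ak) t^k. Choose a root
    in each connected component of Gamma. The vertices that are not roots number
    r - s, and they yield both bounds on the dimension.

    Upper bound. Linear relations force every linear function of the exponent that
    agrees on the two ends of each relation x_k u_a = x_l u_b to be constant on all
    generators: the part of a linear syzygy supported on one level set of the
    function is again a syzygy, hence so is that part of any syzygy, and applied to
    the trivial syzygy between two generators on different levels this is absurd
    ([linear_relations_const]). Sums of the exponents over a component of Gamma are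
    such functions, so a product of k generators is determined by k and its
    exponents at the nonroots ([expo_determined]). Hence the products of at most N
    generators span a space of dimension O(N^(r - s + 1)). On the other hand, if
    x_i lies in P_(i+1) but not in P_i for a chain P_0, ..., P_e of primes, then the
    monomials in x_0, ..., x_(e-1) are linearly independent modulo P_0
    ([chain_monoms_free]); there are N^e of them with exponents below N, and so
    e <= r - s + 1 ([prime_chain_le_growth]).

    Lower bound. For a set T of nonroots, keep the degree kd part of the
    coefficient of t^k and put x_i = 1 for all i outside T. This defines a ring
    morphism from F to the domain S[t], whose kernel is prime. A path in Gamma from
    a nonroot j to its root gives two products of equally many generators whose
    exponents differ only at j and at the root ([connect_expo]); their difference
    is in the kernel for T but not in the kernel for T with j added. Removing the
    nonroots one at a time and ending with the ideal of the elements of F without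
    constant term gives a chain of r - s + 1 strict inclusions. *)

Set Implicit Arguments.
Unset Strict Implicit.
Unset Printing Implicit Defensive.

Import GRing.Theory.
Local Open Scope ring_scope.
Local Open Scope quotient_scope.

(** * Prime ideals and chains of prime ideals *)

Section PrimeIdeals.
Variable A : comNzRingType.
Implicit Types P : {pred A}.

Lemma prime_ideal0 P : prime_ideal P -> 0 \in P.
Proof. by case=> -[]. Qed.

Lemma prime_ideal1 P : prime_ideal P -> 1 \notin P.
Proof. by case=> -[]. Qed.

Lemma prime_idealMl P a u : prime_ideal P -> u \in P -> a * u \in P.
Proof. by case=> -[P0 _ PM] _ Pu; rewrite -[_ * _]addr0 PM. Qed.

Lemma prime_idealD P u v : prime_ideal P -> u \in P -> v \in P -> u + v \in P.
Proof. by case=> -[P0 _ PM] _ Pu Pv; rewrite -[u]mul1r PM. Qed.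

Lemma prime_ideal_sum P (T : eqType) (s : seq T) (p : pred T) (F : T -> A) :
  prime_ideal P -> (forall i, i \in s -> p i -> F i \in P) ->
  \sum_(i <- s | p i) F i \in P.
Proof.
move=> prP FP; rewrite big_seq_cond; elim/big_rec: _ => [|i x /andP[si pi] Px].
  exact: prime_ideal0.
by apply: prime_idealD => //; apply: FP.
Qed.

Lemma prime_idealX P a k : prime_ideal P -> a \notin P -> a ^+ k \notin P.
Proof.
move=> prP aP; elim: k => [|k IHk]; first by rewrite expr0 prime_ideal1.
apply/negP; rewrite exprS => /(proj2 prP) /orP[]; exact/negP.
Qed.

End PrimeIdeals.

Lemma prime_ideal_kernel (A : comNzRingType) (B : idomainType) (f : A -> B) :
  {morph f : x y / x + y} -> {morph f : x y / x * y} -> f 1 = 1 ->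
  prime_ideal [pred x | f x == 0].
Proof.
move=> fD fM f1; have f0 : f 0 = 0.
  by apply: (addrI (f 0)); rewrite -fD !addr0.
split; last by move=> x y; rewrite !inE fM mulf_eq0.
split; rewrite ?inE ?f0 ?f1 ?oner_eq0 // => a x y; rewrite !inE => /eqP fx /eqP fy.
by rewrite fD fM fx fy mulr0 addr0.
Qed.

Lemma prime_chain_steps (A : comNzRingType) (e : nat) (P : nat -> {pred A}) :
  (forall i, prime_ideal (P i)) ->
  (forall i, (i < e)%N -> {subset P i <= P i.+1} /\ ~ {subset P i.+1 <= P i}) ->
  prime_chain (fun i : 'I_e.+1 => P i).
Proof.
move=> prP stepP; have sub i j : (i <= j <= e)%N -> {subset P i <= P j}.
  elim: j => [|j IH]; first by rewrite leqn0 => /andP[/eqP-> _] x.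
  rewrite leq_eqVlt ltnS => /andP[/orP[/eqP->|le_ij] lt_je] x xP //.
  by apply: (proj1 (stepP j lt_je)); apply: IH; rewrite // le_ij ltnW.
split=> // i j lt_ij; have le_je : (j <= e)%N by rewrite -ltnS.
split; first by apply: sub; rewrite ltnW.
have [_ nsub] := stepP i (leq_trans lt_ij le_je).
by move=> sub_ji; apply: nsub => x xP; apply: sub_ji; apply: sub xP; rewrite lt_ij.
Qed.

(** * The growth of an algebra bounds its chains of primes *)

Section ChainIndependence.
Variables (K : fieldType) (A : comNzRingType) (kap : {rmorphism K -> A}).

Definition monom (x : seq A) (e : seq nat) : A :=
  \prod_(p <- zip x e) p.1 ^+ p.2.

Lemma monom_cons a x h t : monom (a :: x) (h :: t) = a ^+ h * monom x t.
Proof. by rewrite /monom /= big_cons. Qed.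

(** Let j be the lowest exponent of x_0 in a relation modulo P_0. As x_0 is not in
    P_0, the relation may be divided by x_0^j; as x_0 is in P_1, reducing modulo P_1
    leaves only the terms that had exponent exactly j, a relation between monomials
    in the remaining x_i modulo P_1. *)
Lemma chain_monoms_free (P : nat -> {pred A}) (x : seq A) :
  (forall i, (i <= size x)%N -> prime_ideal (P i)) ->
  (forall i, (i < size x)%N -> {subset P i <= P i.+1}) ->
  (forall i, (i < size x)%N -> nth 0 x i \in P i.+1 /\ nth 0 x i \notin P i) ->
  forall (s : seq (seq nat)) (c : seq nat -> K),
    uniq s -> all (fun e => size e == size x) s ->
    \sum_(e <- s) kap (c e) * monom x e \in P 0 ->
    forall e, e \in s -> c e = 0.
Proof.
elim: x P => [|a x IHx] P prP incP xP s c uniq_s size_s sum_s.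
  move=> e es; have e0: e = [::] by apply/nilP; apply: (allP size_s).
  have s1: s = [:: [::]].
    case: s uniq_s size_s {sum_s} es => [|e1 [|e2 s]] //=.
      by move=> _ /andP[/nilP-> _].
    by move=> H /and3P[/nilP e1E /nilP e2E _]; rewrite e1E e2E inE eqxx in H.
  have pr0 := prP 0%N isT.
  move: sum_s; rewrite s1 big_seq1 /monom big_nil mulr1 e0 => cP.
  apply/eqP/negPn/negP => c_neq0; have := prime_ideal1 pr0.
  rewrite -(rmorph1 kap) -(mulVf c_neq0) rmorphM /=.
  by rewrite prime_idealMl.
suff: forall j e, e \in s -> head 0%N e = j -> c e = 0 by move=> h e /h; apply.
elim/ltn_ind => j IHj e es ej.
have pr0 := prP 0%N isT; have pr1 : prime_ideal (P 1%N) by apply: prP.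
have [aP1 aP0] := xP 0%N isT; rewrite /= in aP1 aP0.
have consE e' : e' \in s -> e' = head 0%N e' :: behead e'.
  by move=> /(allP size_s); case: e'.
(* Divide the relation by the j-th power of a, the lowest one that occurs. *)
have sumE : \sum_(e <- s) kap (c e) * monom (a :: x) e = a ^+ j *
    \sum_(e <- s) kap (c e) * (a ^+ (head 0%N e - j) * monom x (behead e)).
  rewrite mulr_sumr; apply: eq_big_seq => e' e's; have [lt_j|le_j] := ltnP (head 0%N e') j.
    by rewrite (IHj _ lt_j e' e's erefl) rmorph0 !mul0r mulr0.
  rewrite [RHS]mulrCA; congr (_ * _).
  by rewrite {1}(consE _ e's) monom_cons mulrA -exprD subnKC.
move: sum_s; rewrite sumE => /(proj2 pr0); rewrite (negPf (prime_idealX j pr0 aP0)) /= => sumP.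
have {}sumP := incP 0%N isT _ sumP.
pose s' := [seq e' <- s | head 0%N e' == j].
have sumP1 : \sum_(t <- map behead s') kap (c (j :: t)) * monom x t \in P 1%N.
  rewrite big_map big_filter.
  move: sumP; rewrite (bigID (fun e' => head 0%N e' == j)) /=.
  set u := \sum_(_ <- _ | _) _; set v := \sum_(_ <- _ | _) _ => uvP.
  rewrite (_ : \sum_(_ <- _ | _) _ = (u + v) + (-1) * v); last first.
    rewrite mulN1r addrK big_seq_cond /u [RHS]big_seq_cond.
    apply: eq_bigr => e' /andP[e's /eqP e'j].
    by rewrite e'j subnn expr0 mul1r -[in LHS]e'j -consE.
  apply: prime_idealD => //; apply: prime_idealMl => //.
  apply: prime_ideal_sum => // e' e's e'j.
  have [lt_j|le_j] := ltnP (head 0%N e') j.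
    by rewrite (IHj _ lt_j e' e's erefl) rmorph0 mul0r prime_ideal0.
  have {e'j le_j} : (j < head 0%N e')%N by rewrite ltn_neqAle eq_sym e'j le_j.
  rewrite -subn_gt0; case: (_ - _)%N => // k _.
  by rewrite exprS -mulrA mulrCA mulrC prime_idealMl.
rewrite (consE _ es) ej.
apply: (IHx (fun i => P i.+1) _ _ _ (map behead s') (fun t => c (j :: t)) _ _ sumP1).
- by move=> i; apply: (prP i.+1).
- by move=> i; apply: (incP i.+1).
- by move=> i; apply: (xP i.+1).
- rewrite map_inj_in_uniq ?filter_uniq // => e1 e2.
  rewrite !mem_filter => /andP[/eqP h1 /consE e1E] /andP[/eqP h2 /consE e2E] e12.
  by rewrite e1E e2E h1 h2 e12.
- rewrite all_map; apply/allP => e'; rewrite mem_filter => /andP[_ /(allP size_s)].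
  by case: e'.
- by apply: map_f; rewrite mem_filter ej eqxx.
Qed.

(** The coordinates of the m i in the spanning family form a matrix with more rows
    than columns, so its left kernel is not zero. *)
Lemma linear_dependence (E L : finType) (m : E -> A) (h : L -> A) :
  (#|L| < #|E|)%N ->
  (forall i, exists c : L -> K, m i = \sum_l kap (c l) * h l) ->
  exists2 v : E -> K, (exists i, v i != 0) & \sum_i kap (v i) * m i = 0.
Proof.
move=> ltLE /choice[c cE].
pose M : 'M[K]_(#|E|, #|L|) := \matrix_(i, j) c (enum_val i) (enum_val j).
have : kermx M != 0.
  rewrite kermx_eq0 /row_free neq_ltn; apply/orP; left.
  exact: leq_ltn_trans (rank_leq_col _) ltLE.
case/rowV0Pn => v /sub_kermxP vM v0.
exists (fun i => v 0 (enum_rank i)).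
  have /rV0Pn[i vi] := v0; exists (enum_val i); by rewrite enum_valK.
under eq_bigr do rewrite cE mulr_sumr.
rewrite exchange_big big1 //= => l _.
under eq_bigr do rewrite mulrA -rmorphM.
rewrite -mulr_suml -rmorph_sum /=.
have /matrixP/(_ 0 (enum_rank l)) := vM; rewrite !mxE => vMl.
rewrite [X in kap X](_ : _ = 0) ?rmorph0 ?mul0r // -[RHS]vMl.
rewrite (reindex_onto enum_rank enum_val) /=; last by move=> i _; rewrite enum_valK.
apply: eq_big => [i|i _]; first by rewrite enum_rankK eqxx.
by rewrite mxE !enum_rankK.
Qed.

(** Dimension is at most Gelfand-Kirillov dimension. A chain of length e provides
    N^e independent monomials of exponents below N ([chain_monoms_free]); they lie in
    a filtration step that is linear in N, hence in a space of dimension O(N^rho). *)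
Lemma prime_chain_le_growth (V : nat -> A -> Prop) (C rho : nat) :
  V 0%N 1 ->
  (forall i j x y, V i x -> V j y -> V (i + j)%N (x * y)) ->
  (forall i j x, (i <= j)%N -> V i x -> V j x) ->
  (forall x, exists N, V N x) ->
  (forall N, exists L : finType, exists2 h : L -> A,
     (#|L| <= (C * N.+1) ^ rho)%N &
     forall x, V N x -> exists c : L -> K, x = \sum_l kap (c l) * h l) ->
  forall (e : nat) (P : 'I_e.+1 -> {pred A}), prime_chain P -> (e <= rho)%N.
Proof.
move=> V1 VM Vmono Vex Vspan e P [prP ltP]; rewrite leqNgt; apply/negP => lt_rho.
have [y yP] : {y : 'I_e -> A & forall i : 'I_e,
    y i \in P (inord i.+1) /\ y i \notin P (inord i)}.
  apply: (@choice _ _ (fun (i : 'I_e) a =>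
    a \in P (inord i.+1) /\ a \notin P (inord i))) => i; have lti := ltn_ord i.
  have [|_ nsub] := ltP (inord i) (inord i.+1); first by rewrite !inordK // ltnW.
  apply: contrapT => /forallNP no; apply: nsub => z zP.
  by apply/negPn/negP => zP'; apply: (no z).
pose x := [seq y i | i <- enum 'I_e].
have size_x : size x = e by rewrite size_map size_enum_ord.
have nth_x (i : 'I_e) : nth 0 x i = y i.
  by rewrite (nth_map i) ?size_enum_ord // nth_ord_enum.
have [D xD] : exists D, forall a, a \in x -> V D a.
  elim: (x) => [|a x' [D IH]]; first by exists 0%N.
  have [N aN] := Vex a; exists (maxn D N) => b; rewrite inE => /orP[/eqP->|/IH].
    by apply: Vmono aN; rewrite leq_maxr.
  by apply: Vmono; rewrite leq_maxl.
have VX a k : V D a -> V (k * D)%N (a ^+ k).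
  by move=> aD; elim: k => // k IH; rewrite exprS mulSn; apply: VM.
(* With this N, the bound (B N)^rho on the dimension is below N^(rho+1). *)
pose B := (C * (e * D).+1)%N; pose N := (B ^ rho).+1.
have monoV (t : e.-tuple 'I_N) : V (e * (N * D))%N (monom x (map val t)).
  have /= size_t := size_tuple t; rewrite -{1}size_t; move: (tval t) size_t => {t} t.
  rewrite -size_x; elim: (x) t xD => [|a x' IH] [|h t] //= xD'.
    by move=> _; rewrite /monom big_nil mul0n; apply: V1.
  case=> size_t; rewrite monom_cons mulSn; apply: VM.
    apply: (@Vmono (h * D)%N); first by rewrite leq_mul2r ltnW ?orbT.
    by apply: VX; apply: xD'; rewrite inE eqxx.
  by apply: IH size_t => // b bx; apply: xD'; rewrite inE bx orbT.
have [L [h cardL hP]] := Vspan (e * (N * D))%N.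
have ltLE : (#|L| < #|{: e.-tuple 'I_N}|)%N.
  apply: leq_ltn_trans cardL _; rewrite card_tuple card_ord.
  apply: leq_ltn_trans (_ : ((B * N) ^ rho < _)%N).
    case: (rho) => // r; rewrite leq_exp2r // /B -mulnA leq_mul2l; apply/orP; right.
    by rewrite mulSn mulnCA [(N * _)%N]mulnC -add1n leq_add2r.
  apply: (@leq_trans (N ^ rho.+1)); last exact: leq_pexp2l.
  by rewrite expnMn expnS ltn_mul2r expn_gt0 /= ltnSn.
have [v [t vt] rel] := linear_dependence ltLE (fun t => hP _ (monoV t)).
pose w (t : e.-tuple 'I_N) : seq nat := map val t.
have w_inj : injective w by move=> t1 t2 /(inj_map val_inj)/val_inj.
pose c f := if [pick t | w t == f] is Some t then v t else 0.
have cw u : c (w u) = v u.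
  rewrite /c; case: pickP => [u' /eqP/w_inj->//|/(_ u)]; by rewrite eqxx.
pose P' i := P (inord i).
move/eqP: vt; case; rewrite -cw.
apply: (@chain_monoms_free P' x _ _ _ (codom w) c); rewrite ?size_x.
- by move=> i _; apply: prP.
- by move=> i lti; have [] := ltP (inord i) (inord i.+1) _; rewrite ?inordK // ltnW.
- by move=> i lti; rewrite (nth_x (Ordinal lti)); apply: yP.
- by rewrite map_inj_uniq ?enum_uniq.
- by apply/allP => _ /codomP[u ->]; rewrite /w size_map size_tuple.
- have -> : \sum_(f <- codom w) kap (c f) * monom x f = 0.
    by rewrite big_map big_enum -[RHS]rel; apply: eq_bigr => u _; rewrite cw.
  by apply: prime_ideal0; apply: prP.
- exact: codom_f.
Qed.

End ChainIndependence.

(** * Linear syzygies and functions that are constant on the generators *)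

Section LinearRelations.
Variables (K : fieldType) (n m : nat) (u : m.-tuple 'X_{1..n}).
Local Notation S := {mpoly K[n]}.

(** [part w] keeps the terms of the syzygy w that sit on the level of f through
    u_a. If w has linear entries, then two terms contributing to the same monomial
    come from some x_k u_i = x_l u_j, so they sit on the same level, and [part w]
    vanishes with the full sum. By linearity [part] vanishes on all syzygies, but its
    value at u_b e_a - u_a e_b is u_a u_b when f separates u_a from u_b. *)
Lemma linear_relations_const (f : 'X_{1..n} -> nat) :
  (forall w : 'rV[S]_m, syzygy u w -> w \in submod_gen (linear_syzygy u)) ->
  (forall a b k l, (U_(k) + tnth u a)%MM = (U_(l) + tnth u b)%MM ->
     f (tnth u a) = f (tnth u b)) ->
  forall a b, f (tnth u a) = f (tnth u b).
Proof.
move=> lin_u f_step a b; apply/eqP/negPn/negP => neq_f.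
pose lev i := f (tnth u i) == f (tnth u a).
pose part (w : 'rV[S]_m) := \sum_(i | lev i) w 0 i * 'X_[tnth u i].
have part_lin w : linear_syzygy u w -> part w = 0.
  move=> [syz_w lin_w]; apply/mpolyP => mu; rewrite raddf_sum mcoeff0 /=.
  have supp i : (w 0 i * 'X_[tnth u i])@_mu != 0 ->
      exists k, mu = (U_(k) + tnth u i)%MM.
    rewrite -mcoeff_msupp (perm_mem (msuppMX _ _)) => /mapP[nu nu_w ->].
    have /eqP/mdeg1P[k /eqP->] := dhomog_mf (lin_w i) nu_w.
    by exists k; rewrite addmC.
  have [/existsP[i /andP[lev_i /supp[k muE]]]|/existsPn no] :=
      boolP [exists i, lev i && ((w 0 i * 'X_[tnth u i])@_mu != 0)].
    move/(congr1 (mcoeff mu)): (syz_w); rewrite raddf_sum mcoeff0 /= => tot; rewrite -[RHS]tot.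
    rewrite [RHS](bigID lev) /= [X in _ + X]big1 ?addr0 // => j.
    apply: contraNeq => /supp[l muE']; rewrite /lev -(eqP lev_i).
    by apply/eqP; apply: (f_step _ _ l k); rewrite -muE -muE'.
  rewrite big1 // => i lev_i; have := no i.
  by rewrite lev_i /= negbK => /eqP.
have part0 w : syzygy u w -> part w = 0.
  move=> /lin_u/submod_genP[s [lin_s ->]]; rewrite /part.
  under eq_bigr do rewrite summxE mulr_suml.
  rewrite exchange_big big1_seq //= => x /lin_s/part_lin part_x.
  under eq_bigr do rewrite mxE -mulrA.
  by rewrite -mulr_sumr -/(part _) part_x mulr0.
have neq_ab : a != b by apply: contraNneq neq_f => ->.
(* The trivial syzygy between the generators a and b. *)
pose w : 'rV[S]_m := \row_i (if i == a then 'X_[tnth u b]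
  else if i == b then - 'X_[tnth u a] else 0).
have syz_w : syzygy u w.
  rewrite /syzygy (bigD1 a) //= (bigD1 b) 1?eq_sym //= big1 => [|i /andP[ia ib]].
    by rewrite !mxE eqxx eq_sym (negPf neq_ab) eqxx mulNr mulrC addr0 subrr.
  by rewrite mxE (negPf ia) (negPf ib) mul0r.
have := part0 w syz_w; rewrite /part (bigD1 a) /lev //= big1 => [|i /andP[fi ia]].
  rewrite addr0 mxE eqxx -mpolyXD => /(congr1 (mcoeff (tnth u b + tnth u a))).
  by rewrite mcoeffX eqxx mcoeff0 => /eqP; rewrite oner_eq0.
rewrite mxE (negPf ia); case: eqP => [ib|]; last by rewrite mul0r.
by rewrite -ib eq_sym fi in neq_f.
Qed.

End LinearRelations.

(** * Ideals given by generators *)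

(** Proves properties that survive adding multiples of generators without handling
    explicit representations. *)
Lemma ideal_gen_ind (A : comNzRingType) (B : A -> Prop) (Q : A -> Prop) :
  Q 0 -> (forall a b p, B b -> Q p -> Q (a * b + p)) ->
  forall p, p \in ideal_gen B -> Q p.
Proof.
move=> Q0 QS p /(@submod_genP A A^o)[s [Bs ->]]; rewrite big_seq.
by elim/big_rec: _ => // x q xs; apply: QS; apply: Bs.
Qed.

Lemma ideal_gen_sub (A : comNzRingType) (B C : A -> Prop) :
  (forall b, B b -> b \in ideal_gen C) -> {subset ideal_gen B <= ideal_gen C}.
Proof.
move=> BC; apply: ideal_gen_ind; first exact: ideal_gen0.
by move=> a b p /BC; apply: ideal_genMD.
Qed.

Lemma is_idealM (A : comNzRingType) (I : {pred A}) a p :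
  is_ideal I -> p \in I -> a * p \in I.
Proof. by case=> I0 IM Ip; rewrite -[_ * _]addr0; apply: IM. Qed.

Lemma is_ideal_sum (A : comNzRingType) (I : {pred A}) (T : eqType) (s : seq T)
    (F : T -> A) :
  is_ideal I -> (forall x, x \in s -> F x \in I) -> \sum_(x <- s) F x \in I.
Proof.
move=> [I0 IM] FI; rewrite big_seq; elim/big_rec: _ => // x p xs Ip.
by rewrite -[F x]mul1r IM // FI.
Qed.

Lemma is_ideal_gen (A : comNzRingType) (B : A -> Prop) : is_ideal (ideal_gen B).
Proof. by split=> [|a u v]; [apply: ideal_gen0 | apply: ideal_genMD]. Qed.

(** * Monomial ideals and their linear relation graph *)

Section MonomialIdeal.
Variables (K : fieldType) (n : nat).
Local Notation S := {mpoly K[n]}.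
Variable I : {pred S}.

Lemma monomial_ideal_supp : is_ideal I -> monomial_ideal I ->
  forall p v, p \in I -> v \in msupp p -> 'X_[v] \in I.
Proof.
move=> idI [M IE] p v; rewrite IE => pI; elim/ideal_gen_ind: pI v => {p}.
  by move=> v; rewrite msupp0.
move=> a _ p [w Mw ->] IH v /msuppD_le; rewrite mem_cat => /orP[|/IH//].
rewrite (perm_mem (msuppMX _ _)) => /mapP[w' _ ->].
rewrite addmC mpolyXD is_idealM // IE; apply: ideal_gen_mem; by exists w.
Qed.

Lemma min_gen_below v : 'X_[v] \in I ->
  exists2 w : 'X_{1..n}, min_gen I w & (w <= v)%MM.
Proof.
have [k] := ubnP (mdeg v); elim: k v => // k IHk v le_k Iv.
have [min_v|] := pselect (min_gen I v); first by exists v => //; apply: lepm_refl.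
move=> /not_andP[//|/existsNP[w /not_implyP[Iw /not_implyP[le_wv neq_wv]]]].
have vE := submK le_wv.
have lt_wv : (mdeg w < mdeg v)%N.
  rewrite -vE mdegD -[X in (X < _)%N]add0n ltn_add2r lt0n mdeg_eq0.
  by apply/eqP => sub0; case: neq_wv; rewrite -vE sub0 add0m.
have [w' min_w' le_w'] := IHk w (leq_trans lt_wv le_k) Iw.
exists w' => //; apply/mnm_lepP => i.
exact: leq_trans (mnm_lepP le_w' i) (mnm_lepP le_wv i).
Qed.

(** The homogeneous generators B need not be monomials. Still, w lies above some
    monomial of an element of B; that monomial is in I because I is monomial, and it
    equals w by minimality. *)
Lemma min_gen_deg (d : nat) (B : S -> Prop) : is_ideal I -> monomial_ideal I ->
  (forall p, B p -> p \is d.-homog) -> I =i ideal_gen B ->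
  forall w, min_gen I w -> mdeg w = d.
Proof.
move=> idI monI homB IE w [Iw min_w].
suff H p : p \in ideal_gen B -> forall v, v \in msupp p ->
    exists2 v0 : 'X_{1..n}, (v0 <= v)%MM & mdeg v0 = d /\ 'X_[v0] \in I.
  rewrite IE in Iw; have [|v0 le_v0 [<- Iv0]] := H _ Iw w; first exact/mem_msuppXP.
  by rewrite (min_w v0).
move=> pB; elim/ideal_gen_ind: pB => {p} [|a b p Bb IH] v; first by rewrite msupp0.
move=> /msuppD_le; rewrite mem_cat => /orP[|/IH//].
move=> /msuppM_le/allpairsP[[v1 v0] /= [_ v0b ->]]; exists v0.
  exact: lem_addl.
split; first exact: dhomog_mf (homB b Bb) _ v0b.
by apply: monomial_ideal_supp v0b => //; rewrite IE; apply: ideal_gen_mem.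
Qed.

Variables (m : nat) (u : m.-tuple 'X_{1..n}).
Hypotheses (idI : is_ideal I) (monI : monomial_ideal I).
Hypothesis uP : forall v, v \in u <-> min_gen I v.

Lemma min_gen_tnth a : min_gen I (tnth u a).
Proof. by apply/uP; apply: mem_tnth. Qed.

Lemma min_gen_index v : min_gen I v -> exists a, v = tnth u a.
Proof. by move/uP => /tnthP. Qed.

Definition expo (t : seq 'I_m) : 'X_{1..n} := (\big[+%MM/0%MM]_(a <- t) tnth u a)%MM.

Lemma expo_nil : expo [::] = 0%MM.
Proof. by rewrite /expo big_nil. Qed.

Lemma expo_cons a t : expo (a :: t) = (tnth u a + expo t)%MM.
Proof. by rewrite /expo big_cons. Qed.

Lemma expo_cat t t' : expo (t ++ t') = (expo t + expo t')%MM.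
Proof. by rewrite /expo big_cat. Qed.

Lemma expoE t i : expo t i = (\sum_(a <- t) tnth u a i)%N.
Proof.
elim: t => [|a t IH]; first by rewrite expo_nil big_nil mnm0E.
by rewrite expo_cons mnmDE IH big_cons.
Qed.

Definition pow_gens (k : nat) (p : S) : Prop :=
  exists2 t, size t = k & p = 'X_[expo t].

(** Each element of I is a combination of minimal generators, because each of its
    monomials lies in I and hence above one of them; products of such combinations
    expand into products of generators. *)
Lemma ideal_pow_gens k : ideal_pow I k =i ideal_gen (pow_gens k).
Proof.
move=> p; apply/idP/idP; apply: ideal_gen_sub => {}p; last first.
  move=> [t size_t ->]; apply: ideal_gen_mem.
  have size_t' : size [seq 'X_[tnth u a] : S | a <- t] == k.
    by rewrite size_map size_t.
  exists (Tuple size_t').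
    by rewrite /= all_map; apply/allP => a _; case: (min_gen_tnth a).
  rewrite /= big_map /expo; elim: {size_t size_t'} t => [|a t IH].
    by rewrite !big_nil mpolyX0.
  by rewrite !big_cons mpolyXD IH.
have gen1 q : q \in I -> q \in ideal_gen (pow_gens 1).
  move=> Iq; rewrite [q]mpolyE; apply: is_ideal_sum; first exact: is_ideal_gen.
  move=> v vq; rewrite -mul_mpolyC; apply: is_idealM; first exact: is_ideal_gen.
  have [w /min_gen_index[a ->] le_v] := min_gen_below (monomial_ideal_supp idI monI Iq vq).
  rewrite -(submK le_v) mpolyXD; apply: is_idealM; first exact: is_ideal_gen.
  apply: ideal_gen_mem; exists [:: a] => //.
  by rewrite expo_cons expo_nil addm0.
move=> [t tI ->]; case: t tI => s /= /eqP <- {k}.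
elim: s => [_|q s IH /andP[Iq sI]].
  by rewrite big_nil; apply: ideal_gen_mem; exists [::] => //; rewrite expo_nil mpolyX0.
rewrite big_cons; apply: ideal_genM (gen1 q Iq) (IH sI).
move=> _ _ [t1 size1 ->] [t2 size2 ->]; exists (t1 ++ t2).
  by rewrite size_cat size1 size2.
by rewrite expo_cat mpolyXD.
Qed.

Lemma expo_ideal_pow t : 'X_[expo t] \in ideal_pow I (size t).
Proof. by rewrite ideal_pow_gens; apply: ideal_gen_mem; exists t. Qed.

Lemma mdeg_expo d t : (forall w, min_gen I w -> mdeg w = d) ->
  mdeg (expo t) = (size t * d)%N.
Proof.
move=> deg_d; elim: t => [|a t IH]; first by rewrite expo_nil mdeg0.
by rewrite expo_cons mdegD IH deg_d //; apply: min_gen_tnth.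
Qed.

Local Notation e := (linear_relation_graph I).

Lemma edgeI a b k l : (U_(k) + tnth u a)%MM = (U_(l) + tnth u b)%MM ->
  k = l \/ e k l.
Proof.
move=> rel; have [|neq] := eqVneq k l; [by left | right].
rewrite /linear_relation_graph neq; apply/asboolP.
exists (tnth u a), (tnth u b); split; try exact: min_gen_tnth.
by rewrite -!mpolyXD rel.
Qed.

Lemma edgeP k l : e k l ->
  exists a b, (U_(k) + tnth u a)%MM = (U_(l) + tnth u b)%MM.
Proof.
case/andP=> _ /asboolP[v [w [/min_gen_index[a ->] /min_gen_index[b ->]]]].
rewrite -!mpolyXD => /(congr1 (fun p => p@_(U_(k) + tnth u a)%MM)).
rewrite !mcoeffX eqxx; case: eqP => [rel _|_ /eqP]; last by rewrite oner_eq0.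
by exists a, b.
Qed.

(** Multiplying the relations x_k u_a = x_l u_b along a path makes the intermediate
    variables cancel. *)
Lemma connect_expo k l : connect e k l ->
  exists t t', size t = size t' /\ (U_(k) + expo t)%MM = (U_(l) + expo t')%MM.
Proof.
case/connectP=> p; elim: p k => [|i p IH] k /=.
  by move=> _ ->; exists [::], [::].
case/andP=> /edgeP[a [b rel]] path_p /(IH i path_p)[t [t' [size_t rel']]].
exists (a :: t), (b :: t'); rewrite /= size_t !expo_cons; split=> //.
by rewrite addmA rel -addmA [X in (_ + X)%MM]addmC addmA rel' -addmA
  [X in (_ + X)%MM]addmC.
Qed.

(** A relation x_k u_a = x_k' u_b does not change the sum over a component,
    because k and k' are adjacent or equal. *)
Lemma component_sum_const :
  (forall w : 'rV[S]_m, syzygy u w -> w \in submod_gen (linear_syzygy u)) ->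
  forall l a b, (\sum_(i | connect e l i) tnth u a i =
                 \sum_(i | connect e l i) tnth u b i)%N.
Proof.
move=> lin_u l; pose f (v : 'X_{1..n}) := (\sum_(i | connect e l i) v i)%N.
apply: (linear_relations_const (f := f) lin_u) => a b k k' rel.
have conn_kk' : connect e l k = connect e l k'.
  have sym_e := sym_connect_sym (linear_relation_graph_sym I).
  rewrite -!(sym_e _ l); apply: same_connect => //.
  by have [->|/connect1] := edgeI rel; first exact: connect0.
have fU i : f U_(i)%MM = connect e l i.
  rewrite /f (eq_bigr (fun j => (i == j) : nat)) => [|j _]; last by rewrite mnm1E.
  case li: (connect e l i); last by rewrite big1 // => j; case: eqP => // <-; rewrite li.
  by rewrite (bigD1 i) //= eqxx big1 ?addn0 // => j /andP[_]; rewrite eq_sym => /negPf->.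
have fD v w : f (v + w)%MM = (f v + f w)%N.
  by rewrite /f -big_split; apply: eq_bigr => i _; rewrite mnmDE.
by have := congr1 f rel; rewrite !fD !fU conn_kk' => /addnI.
Qed.

Definition nonroot : pred 'I_n := [pred i | fingraph.root e i != i].

(** An exponent not covered by the hypothesis sits at the root of a component; the
    other exponents in that component are covered, and the sum over the component depends on
    the number of factors only. A variable outside the graph forms a component of its
    own. *)
Lemma expo_determined :
  (forall w : 'rV[S]_m, syzygy u w -> w \in submod_gen (linear_syzygy u)) ->
  forall t t', size t = size t' ->
    (forall i, nonroot i -> expo t i = expo t' i) -> expo t = expo t'.
Proof.
move=> lin_u t t' size_t eq_t; apply/mnmP => l.
have [/eq_t//|/negPn/eqP root_l] := boolP (nonroot l).
have sumE s : (\sum_(i | connect e l i) expo s i =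
    \sum_(a <- s) \sum_(i | connect e l i) tnth u a i)%N.
  by rewrite exchange_big; apply: eq_bigr => i _; rewrite expoE.
have : (\sum_(i | connect e l i) expo t i = \sum_(i | connect e l i) expo t' i)%N.
  rewrite !sumE; elim: t t' size_t {eq_t} => [|a t IH] [|b t'] //= [size_t].
  by rewrite !big_cons (IH t') // (component_sum_const lin_u l a b).
rewrite (bigD1 l) ?connect0 //= [in RHS](bigD1 l) ?connect0 //=.
rewrite (eq_bigr (expo t')) => [/addIn//|i /andP[li neq_il]].
apply: eq_t; apply: contra neq_il => /= /eqP root_i.
rewrite -root_i -root_l eq_sym root_connect //.
exact: sym_connect_sym (linear_relation_graph_sym I).
Qed.

(** An index outside the graph is its own root, so nonroots are vertices. *)
Lemma card_nonroot : #|nonroot| = (#|graph_vertices e| - n_comp e (graph_vertices e))%N.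
Proof.
have -> : n_comp e (graph_vertices e) = #|[predI graph_vertices e & roots e]|.
  by apply: eq_card => i; rewrite !inE andbC.
rewrite -(cardID (roots e) (graph_vertices e)) addKn; apply: eq_card => i.
rewrite !inE /roots; case: eqVneq => //= neq_i; apply/esym.
have /connectP[[|j p] /=] := connect_root e i; first by move=> _ E; rewrite E eqxx in neq_i.
by case/andP=> e_ij _ _; apply/existsP; exists j.
Qed.

End MonomialIdeal.

(** * The fiber ring is spanned by products of generators *)

Section FiberRing.
Variables (K : fieldType) (n : nat) (I : {pred {mpoly K[n]}}).
Local Notation S := {mpoly K[n]}.
Local Notation F := (fiber_ring I).

Lemma rees_const_zmod_morphism : zmod_morphism (@rees_const K n I).
Proof. by move=> p q; apply/val_inj; rewrite /= polyCB. Qed.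

Lemma rees_const_monoid_morphism : monoid_morphism (@rees_const K n I).
Proof. by split=> [|p q]; apply/val_inj; rewrite /= ?polyC1 ?polyCM. Qed.

HB.instance Definition _ :=
  GRing.isZmodMorphism.Build S (rees I) (@rees_const K n I) rees_const_zmod_morphism.
HB.instance Definition _ :=
  GRing.isMonoidMorphism.Build S (rees I) (@rees_const K n I)
    rees_const_monoid_morphism.

Definition fiber_proj : {rmorphism rees I -> F} := \pi_F.
Definition fiber_const : {rmorphism K -> F} :=
  fiber_proj \o @rees_const K n I \o @mpolyC n K.

Lemma fiber_proj_eq a b : (fiber_proj a == fiber_proj b) = (a - b \in @fiber_ideal K n I).
Proof. by rewrite Quotient.idealrBE. Qed.

Lemma fiber_projK x : fiber_proj (repr x) = x.
Proof. exact: reprK. Qed.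

Lemma fiber_proj_X (v : 'X_{1..n}) :
  fiber_proj (rees_const I 'X_[v]) = (v == 0%MM)%:R.
Proof.
case: eqVneq => [->|]; first by rewrite mpolyX0 !rmorph1.
move=> v_neq0; have /existsP[i vi] : [exists i, v i != 0%N].
  apply: contraNT v_neq0 => /existsPn v0; apply/eqP/mnmP => i.
  by rewrite mnm0E; apply/eqP/negPn/v0.
have le_v : (U_(i) <= v)%MM.
  by apply/mnm_lepP => j; rewrite mnm1E; case: eqP => // <-; rewrite lt0n.
apply/eqP; rewrite -(submK le_v) mpolyXD rmorphM /= mulr0n -(rmorph0 fiber_proj).
rewrite fiber_proj_eq subr0 -[_ * _]addr0.
apply: ideal_genMD (ideal_gen0 _); apply: ideal_gen_mem; by exists i.
Qed.

(** A nonconstant monomial is divisible by a variable, and variables vanish in the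
    fiber ring. *)
Lemma fiber_proj_const (a : S) : fiber_proj (rees_const I a) = fiber_const a@_0%MM.
Proof.
rewrite {1}[a]mpolyE 2!rmorph_sum /=.
rewrite (eq_bigr (fun v => if v == 0%MM then fiber_const a@_v else 0)) => [|v _].
  rewrite -big_mkcond /=; case: (boolP (0%MM \in msupp a)) => [a0|a0].
    by rewrite -big_filter filter_pred1_uniq ?msupp_uniq // big_seq1.
  rewrite big1_seq => [|v /andP[/eqP-> a0']]; last by rewrite a0' in a0.
  by rewrite (memN_msupp_eq0 a0) !rmorph0.
rewrite -mul_mpolyC 2!rmorphM /= fiber_proj_X.
by case: eqP => _; rewrite ?mulr1 ?mulr0.
Qed.

Lemma rees_pow_mem k (q : S) : q \in ideal_pow I k -> q *: 'X^k \in rees_pred I.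
Proof.
move=> Iq; apply/rees_predP => j; rewrite coefZ coefXn.
by case: eqP => [->|_]; rewrite ?mulr1 // mulr0 ideal_gen0.
Qed.

Definition rees_pow k (q : S) (Iq : q \in ideal_pow I k) : rees I :=
  Rees (rees_pow_mem Iq).

Variables (m : nat) (u : m.-tuple 'X_{1..n}).
Hypotheses (idI : is_ideal I) (monI : monomial_ideal I).
Hypothesis uP : forall v, v \in u <-> min_gen I v.

Definition rees_mon t : rees I := rees_pow (expo_ideal_pow idI monI uP t).
Definition fiber_mon t : F := fiber_proj (rees_mon t).

Lemma rees_mon_nil : rees_mon [::] = 1.
Proof. by apply/val_inj; rewrite /= expo_nil mpolyX0 scale1r. Qed.

Lemma rees_mon_cat t t' : rees_mon (t ++ t') = rees_mon t * rees_mon t'.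
Proof.
apply/val_inj; rewrite /= expo_cat mpolyXD size_cat exprD.
by rewrite -scalerAl -scalerAr scalerA.
Qed.

Lemma fiber_mon_eq t t' : size t = size t' -> expo u t = expo u t' ->
  fiber_mon t = fiber_mon t'.
Proof.
move=> eq_s eq_e; rewrite /fiber_mon (_ : rees_mon t = rees_mon t') //.
by apply/val_inj; rewrite /= eq_s eq_e.
Qed.

(** This filtration measures growth by the number of factors: it is multiplicative
    and its steps are finite dimensional. *)
Definition fiber_span (N : nat) (x : F) : Prop :=
  exists s : seq (K * seq 'I_m), (forall y, y \in s -> (size y.2 <= N)%N) /\
    x = \sum_(y <- s) fiber_const y.1 * fiber_mon y.2.

Lemma fiber_span0 N : fiber_span N 0.
Proof. by exists [::]; rewrite big_nil. Qed.

Lemma fiber_span_mon N c t : (size t <= N)%N ->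
  fiber_span N (fiber_const c * fiber_mon t).
Proof.
move=> size_t; exists [:: (c, t)]; rewrite big_seq1; split=> // y.
by rewrite inE => /eqP ->.
Qed.

Lemma fiber_spanD N x y : fiber_span N x -> fiber_span N y -> fiber_span N (x + y).
Proof.
move=> [s [sN ->]] [s' [sN' ->]]; exists (s ++ s'); rewrite big_cat; split=> // z.
by rewrite mem_cat => /orP[/sN|/sN'].
Qed.

Lemma fiber_span_sum N (T : Type) (s : seq T) (f : T -> F) :
  (forall i, fiber_span N (f i)) -> fiber_span N (\sum_(i <- s) f i).
Proof.
move=> fN; elim/big_rec: _ => [|i x _]; first exact: fiber_span0.
exact: fiber_spanD.
Qed.

Lemma fiber_span_mono i j x : (i <= j)%N -> fiber_span i x -> fiber_span j x.
Proof.
move=> le_ij [s [si ->]]; exists s; split=> // y /si le_i.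
exact: leq_trans le_ij.
Qed.

Lemma fiber_spanM i j x y :
  fiber_span i x -> fiber_span j y -> fiber_span (i + j) (x * y).
Proof.
move=> [s [si ->]] [s' [sj ->]].
exists [seq (z.1 * z'.1, z.2 ++ z'.2) | z <- s, z' <- s']; split.
  move=> _ /allpairsP[[z z'] /= [zs zs' ->]] /=.
  by rewrite size_cat leq_add ?si ?sj.
rewrite big_allpairs_dep mulr_suml; apply: eq_bigr => z _; rewrite mulr_sumr.
apply: eq_bigr => z' _; rewrite rmorphM /fiber_mon rees_mon_cat rmorphM /=.
exact: mulrACA.
Qed.

(** In a combination of products of k generators, the fiber ring only sees the
    constant terms of the coefficients. *)
Lemma rees_pow_span k (q : S) : q \in ideal_pow I k ->
  exists2 r : rees I, val r = q *: 'X^k & fiber_span k (fiber_proj r).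
Proof.
rewrite (ideal_pow_gens idI monI uP) => Iq; elim/ideal_gen_ind: Iq => {q}.
  by exists 0; rewrite ?rmorph0 ?scale0r //; apply: fiber_span0.
move=> a _ q [t size_t ->] [r val_r span_r].
exists (rees_const I a * rees_mon t + r).
  by rewrite /= val_r size_t scalerDl -scalerA mul_polyC.
rewrite rmorphD rmorphM /= fiber_proj_const; apply: fiber_spanD => //.
by apply: fiber_span_mon; rewrite size_t.
Qed.

Lemma fiber_spanP x : exists N, fiber_span N x.
Proof.
rewrite -[x]fiber_projK; move: (repr x) => a.
have /choice[r rP] : forall k, exists r : rees I,
    val r = (val a)`_k *: 'X^k /\ fiber_span k (fiber_proj r).
  move=> k; have /rees_predP/(_ k)/rees_pow_span[r ? ?] := valP a.
  by exists r.
exists (size (val a)).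
have aE : a = \sum_(k < size (val a)) r k.
  apply/val_inj; rewrite rmorph_sum /= -[LHS]coefK poly_def.
  by apply: eq_bigr => k _; case: (rP k).
rewrite [X in fiber_proj X]aE rmorph_sum; apply: fiber_span_sum => k.
by apply: fiber_span_mono (proj2 (rP k)); apply: ltnW.
Qed.

Hypothesis lin_u : forall w : 'rV[S]_m, syzygy u w -> w \in submod_gen (linear_syzygy u).
Variable d : nat.
Hypothesis deg_d : forall w, min_gen I w -> mdeg w = d.

(** A product of k <= N generators is encoded by k and its exponents at the
    nonroots, which are at most d N. Codes that come from no product get the
    vector 0. *)
Lemma fiber_span_card N : exists L : finType, exists2 h : L -> F,
  (#|L| <= (d.+1 * N.+1) ^ #|nonroot I|.+1)%N &
  forall x, fiber_span N x -> exists c : L -> K, x = \sum_l fiber_const (c l) * h l.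
Proof.
pose J := {i | nonroot I i}.
exists {: {ffun J -> 'I_(d * N).+1} * 'I_N.+1}%type.
pose coded (l : {ffun J -> 'I_(d * N).+1} * 'I_N.+1) t :=
  size t = l.2 /\ forall i : J, expo u t (val i) = l.1 i.
pose h l := if pselect (exists t, coded l t) is left ex
            then fiber_mon (projT1 (cid ex)) else 0.
exists h.
  rewrite card_prod card_ffun !card_ord card_sig expnS mulnC.
  apply: leq_mul; first by rewrite leq_pmull.
  case: #|_| => // k; rewrite leq_exp2r // mulSn mulnS addnCA -addn1 addnC.
  by rewrite addnA leq_add2r; lia.
move=> x [s [sN ->]]; elim: s sN => [_|y s IH sN].
  exists (fun=> 0); rewrite big_nil big1 // => l _; by rewrite rmorph0 mul0r.
have [|c cE] := IH; first by move=> z zs; apply: sN; rewrite inE zs orbT.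
have sizeN := sN y (mem_head _ _).
pose l0 : {ffun J -> 'I_(d * N).+1} * 'I_N.+1 :=
  ([ffun i : J => inord (expo u y.2 (val i))], inord (size y.2)).
have code0 : coded l0 y.2.
  split=> [|i]; rewrite /= ?ffunE inordK ?ltnS //.
  apply: leq_trans (_ : (mdeg (expo u y.2) <= _)%N).
    by rewrite mdegE (bigD1 (val i)) //= leq_addr.
  by rewrite (mdeg_expo uP _ deg_d) mulnC leq_mul2l sizeN orbT.
exists (fun l => c l + y.1 *+ (l == l0)).
rewrite (eq_bigr (fun l => fiber_const (c l) * h l +
    fiber_const (y.1 *+ (l == l0)) * h l)) => [|l _]; last by rewrite -mulrDl -rmorphD.
rewrite big_split /= -cE big_cons addrC; congr (_ + _).
rewrite (bigD1 l0) //= big1 => [|l /negPf->]; last by rewrite mulr0n !rmorph0 mul0r.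
rewrite eqxx mulr1n addr0; congr (_ * _); rewrite /h.
case: pselect => [ex|[]]; last by exists y.2.
case: (cid ex) => t [size_t tE] /=; case: code0 => size_y yE.
have eq_s : size y.2 = size t by rewrite size_t size_y.
apply: fiber_mon_eq => //; apply: (expo_determined uP lin_u eq_s) => i Ji.
by rewrite -[i]/(val (exist _ i Ji : J)) tE yE.
Qed.

Lemma fiber_prime_chain_le e (P : 'I_e.+1 -> {pred F}) :
  prime_chain P -> (e <= #|nonroot I|.+1)%N.
Proof.
apply: (prime_chain_le_growth (kap := fiber_const) (V := fiber_span)).
- rewrite -[1]mulr1 -{1}(rmorph1 fiber_const) -(rmorph1 fiber_proj) -rees_mon_nil.
  exact: fiber_span_mon.
- exact: fiber_spanM.
- exact: fiber_span_mono.
- exact: fiber_spanP.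
- exact: fiber_span_card.
Qed.

End FiberRing.

(** * Specializing variables to 1 *)

Lemma coefM_low (A : nzRingType) (p q : {poly A}) i j :
  (forall k, (k < i)%N -> p`_k = 0) -> (forall k, (k < j)%N -> q`_k = 0) ->
  (p * q)`_(i + j) = p`_i * q`_j.
Proof.
move=> p0 q0; have le_i : (i < (i + j).+1)%N by rewrite ltnS leq_addr.
rewrite coefM (bigD1 (Ordinal le_i)) //= addKn big1 ?addr0 // => k neq_k.
have [/p0->|le_ik] := ltnP k i; first by rewrite mul0r.
rewrite q0 ?mulr0 //; have := ltn_ord k; move: neq_k; rewrite -val_eqE /=; lia.
Qed.

Section Specialization.
Variables (K : fieldType) (n : nat).
Local Notation S := {mpoly K[n]}.
Implicit Type T : seq 'I_n.

Definition keep T (i : 'I_n) : S := if i \in T then 'X_i else 1.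

Definition specialize T : {rmorphism S -> S} := mmap (@mpolyC n K) (keep T).

(** The extra variable of {poly S} records the degree, so that a homogeneous part
    becomes a coefficient. *)
Definition graded_specialize T : {rmorphism S -> {poly S}} :=
  mmap (polyC \o @mpolyC n K) (fun i => keep T i *: 'X).

Lemma mpoly_rmorph_ext (B : nzRingType) (f g : {rmorphism S -> B}) :
  (forall c, f c%:MP = g c%:MP) -> (forall v, f 'X_[v] = g 'X_[v]) -> f =1 g.
Proof.
move=> fgC fgX p; rewrite [p]mpolyE 2!rmorph_sum; apply: eq_bigr => v _.
by rewrite -mul_mpolyC 2!rmorphM fgC fgX.
Qed.

Definition restrict T (v : 'X_{1..n}) : 'X_{1..n} := [multinom (i \in T) * v i | i < n].

Lemma specializeX T v : specialize T 'X_[v] = 'X_[restrict T v].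
Proof.
rewrite /= mmapX /mmap1 mpolyXE_id; apply: eq_bigr => i _; rewrite mnmE /keep.
by case: ifP; rewrite ?mul1n ?expr1n.
Qed.

Lemma graded_specializeX T v :
  graded_specialize T 'X_[v] = 'X_[restrict T v] *: 'X^(mdeg v).
Proof.
rewrite -specializeX /= !mmapX /mmap1 mdegE -prodrXr -scaler_prod.
by apply: eq_bigr => i _; rewrite exprZn.
Qed.

Lemma restrict_sub T T' v : {subset T' <= T} ->
  restrict T' (restrict T v) = restrict T' v.
Proof.
move=> sub; apply/mnmP => i; rewrite !mnmE.
by have [/sub->|] := boolP (i \in T'); rewrite ?mul1n.
Qed.

Lemma graded_specialize_sub T T' p j : {subset T' <= T} ->
  (graded_specialize T' p)`_j = specialize T' (graded_specialize T p)`_j.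
Proof.
move=> sub; rewrite -coef_map.
pose g : {rmorphism S -> {poly S}} := map_poly (specialize T') \o graded_specialize T.
suff -> : graded_specialize T' p = g p by [].
apply: (mpoly_rmorph_ext (f := graded_specialize T') (g := g)) => [c|v].
  by rewrite /g /= !mmapC /= map_polyC /= mmapC.
rewrite graded_specializeX -(restrict_sub v sub) -specializeX.
by rewrite /g [RHS]/= -/(graded_specialize T) graded_specializeX map_polyZ map_polyXn.
Qed.

End Specialization.
Arguments specialize {K n} T.
Arguments graded_specialize {K n} T.

Section FiberSpecialization.
Variables (K : fieldType) (n : nat) (I : {pred {mpoly K[n]}}).
Local Notation S := {mpoly K[n]}.
Local Notation F := (fiber_ring I).
Variables (m : nat) (u : m.-tuple 'X_{1..n}).
Hypotheses (idI : is_ideal I) (monI : monomial_ideal I).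
Hypothesis uP : forall v, v \in u <-> min_gen I v.
Variable d : nat.
Hypothesis deg_d : forall w, min_gen I w -> mdeg w = d.
Implicit Type T : seq 'I_n.

Lemma graded_specialize_low T k p j : p \in ideal_pow I k -> (j < k * d)%N ->
  (graded_specialize T p)`_j = 0.
Proof.
rewrite (ideal_pow_gens idI monI uP) => pI lt_j.
elim/ideal_gen_ind: pI => {p} [|a _ p [t size_t ->] IH]; first by rewrite rmorph0 coef0.
rewrite rmorphD rmorphM coefD IH addr0 graded_specializeX.
by rewrite -scalerAr coefZ coefMXn (mdeg_expo uP _ deg_d) size_t lt_j mulr0.
Qed.

(** The coefficient of t^k lies in I^k, all of whose monomials have degree at least
    k d; only those of degree exactly k d are kept. Taking this lowest part is
    multiplicative. *)
Definition rees_specialize T (a : rees I) : {poly S} :=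
  \poly_(k < size (val a)) (graded_specialize T (val a)`_k)`_(k * d).

Lemma coef_rees_specialize T a k :
  (rees_specialize T a)`_k = (graded_specialize T (val a)`_k)`_(k * d).
Proof.
rewrite coef_poly; case: ltnP => // le_k.
by rewrite (nth_default 0 le_k) rmorph0 coef0.
Qed.

Lemma rees_specializeD T : {morph rees_specialize T : a b / a + b}.
Proof.
move=> a b; apply/polyP => k.
rewrite [RHS]coefD [X in _ = X + _]coef_rees_specialize.
rewrite [X in _ = _ + X]coef_rees_specialize [LHS]coef_rees_specialize.
have -> : val (a + b) = val a + val b by [].
by rewrite (coefD (val a)) rmorphD [LHS]coefD.
Qed.

Lemma rees_specializeM T : {morph rees_specialize T : a b / a * b}.
Proof.
move=> a b; apply/polyP => k.
rewrite [RHS]coefM [LHS]coef_rees_specialize.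
have -> : val (a * b) = val a * val b by [].
rewrite (coefM (val a)) rmorph_sum [LHS]coef_sum.
apply: eq_bigr => i _; rewrite [X in _ = X * _]coef_rees_specialize.
rewrite [X in _ = _ * X]coef_rees_specialize rmorphM.
have -> : (k * d = i * d + (k - i) * d)%N by rewrite -mulnDl subnKC // -ltnS.
by rewrite coefM_low // => j; apply: graded_specialize_low; apply/rees_predP/valP.
Qed.

Lemma rees_specialize_const T p :
  rees_specialize T (rees_const I p) = ((graded_specialize T p)`_0)%:P.
Proof.
apply/polyP => k; rewrite [LHS]coef_rees_specialize.
rewrite [X in graded_specialize T X]coefC [RHS]coefC; case: k => [|k]; first by rewrite mul0n eqxx.
by rewrite rmorph0 coef0.
Qed.

Lemma rees_specialize1 T : rees_specialize T 1 = 1.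
Proof.
rewrite -(rmorph1 (@rees_const K n I)) rees_specialize_const rmorph1.
by rewrite coefC.
Qed.

(** As an element of degree 0 in t, x_i contributes its part of degree 0 only, which
    is zero. *)
Lemma rees_specialize_fiber T a : a \in @fiber_ideal K n I -> rees_specialize T a = 0.
Proof.
have X0 : rees_specialize T 0 = 0.
  by apply: (addrI (rees_specialize T 0)); rewrite -rees_specializeD !addr0.
elim/ideal_gen_ind => [//|{}a _ b [i ->] b0].
rewrite rees_specializeD rees_specializeM b0 addr0 rees_specialize_const.
by rewrite graded_specializeX mdeg1 coefZ coefX mulr0 mulr0.
Qed.

Lemma rees_specialize_mon T t :
  rees_specialize T (rees_mon idI monI uP t) = 'X_[restrict T (expo u t)] *: 'X^(size t).
Proof.
apply/polyP => k; rewrite [LHS]coef_rees_specialize.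
have -> : val (rees_mon idI monI uP t) = 'X_[expo u t] *: 'X^(size t) by [].
rewrite !coefZ coefXn.
case: eqVneq => [->|_]; last by rewrite mulr0 rmorph0 coef0 mulr0.
rewrite mulr1 graded_specializeX coefZ coefXn.
by rewrite (mdeg_expo uP _ deg_d) eqxx.
Qed.

Definition fiber_specialize T (x : F) : {poly S} := rees_specialize T (repr x).

Lemma fiber_specialize_proj T a :
  fiber_specialize T (fiber_proj I a) = rees_specialize T a.
Proof.
have : fiber_proj I (repr (fiber_proj I a)) == fiber_proj I a by rewrite fiber_projK.
rewrite fiber_proj_eq /fiber_specialize => /(rees_specialize_fiber T) E.
by rewrite -[repr _](subrK a) rees_specializeD E add0r.
Qed.

Lemma fiber_specializeD T : {morph fiber_specialize T : x y / x + y}.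
Proof.
move=> x y; rewrite -[x]fiber_projK -[y]fiber_projK -rmorphD.
by rewrite !fiber_specialize_proj rees_specializeD.
Qed.

Lemma fiber_specializeM T : {morph fiber_specialize T : x y / x * y}.
Proof.
move=> x y; rewrite -[x]fiber_projK -[y]fiber_projK -rmorphM.
by rewrite !fiber_specialize_proj rees_specializeM.
Qed.

Lemma fiber_specialize1 T : fiber_specialize T 1 = 1.
Proof. by rewrite -(rmorph1 (fiber_proj I)) fiber_specialize_proj rees_specialize1. Qed.

Lemma fiber_specialize_mon T t : fiber_specialize T (fiber_mon idI monI uP t) =
  'X_[restrict T (expo u t)] *: 'X^(size t).
Proof. by rewrite /fiber_mon fiber_specialize_proj rees_specialize_mon. Qed.

Definition spec_kernel T : {pred F} := [pred x | fiber_specialize T x == 0].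

Lemma spec_kernel_prime T : prime_ideal (spec_kernel T).
Proof.
apply: prime_ideal_kernel; first exact: fiber_specializeD.
  exact: fiber_specializeM.
exact: fiber_specialize1.
Qed.

(** The specialization for T' factors through the one for T. *)
Lemma spec_kernel_sub T T' : {subset T' <= T} ->
  {subset spec_kernel T <= spec_kernel T'}.
Proof.
move=> sub x; rewrite !inE => /eqP/polyP x0; apply/eqP/polyP => k.
have := x0 k; rewrite /fiber_specialize !coef0.
rewrite [X in X = _ -> _]coef_rees_specialize => {}x0.
by rewrite [LHS]coef_rees_specialize (graded_specialize_sub _ _ sub) x0 rmorph0.
Qed.

(** Specializing every variable to 1 leaves K[t]; this is the preimage of (t). *)
Definition irrelevant_ideal : {pred F} := [pred x | (fiber_specialize [::] x)`_0 == 0].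

Lemma irrelevant_ideal_prime : prime_ideal irrelevant_ideal.
Proof.
apply: (prime_ideal_kernel (f := fun x => (fiber_specialize [::] x)`_0)).
- by move=> x y; rewrite fiber_specializeD coefD.
- by move=> x y; rewrite fiber_specializeM coef0M.
- by rewrite fiber_specialize1 coef1.
Qed.

Lemma spec_kernel_irrelevant : {subset spec_kernel [::] <= irrelevant_ideal}.
Proof. by move=> x; rewrite !inE => /eqP->; rewrite coef0. Qed.

Lemma irrelevant_ideal_strict (a : 'I_m) :
  ~ {subset irrelevant_ideal <= spec_kernel [::]}.
Proof.
move=> /(_ (fiber_mon idI monI uP [:: a])); rewrite !inE fiber_specialize_mon.
rewrite coefZ coefX mulr0 eqxx => /(_ isT)/eqP/polyP/(_ 1%N).
rewrite coefZ coefX mulr1 coef0 => /eqP.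
by rewrite -msupp_eq0 msuppX.
Qed.

(** The witness is the difference of the two products attached to a path from j to
    l: once both variables are put to 1 they agree, but with the variable j kept
    their exponents differ by one. *)
Lemma spec_kernel_strict (j l : 'I_n) T :
  connect (linear_relation_graph I) j l -> l != j -> l \notin T -> j \notin T ->
  ~ {subset spec_kernel T <= spec_kernel (j :: T)}.
Proof.
case/(connect_expo uP) => t [t' [size_t rel]] neq lT jT.
pose g := fiber_mon idI monI uP.
(* As t and t' have the same length, specialization only compares exponents. *)
have kernelE T' : (g t - g t' \in spec_kernel T')
    = (restrict T' (expo u t) == restrict T' (expo u t')).
  rewrite inE; have -> : fiber_specialize T' (g t - g t') =
      ('X_[restrict T' (expo u t)] - 'X_[restrict T' (expo u t')]) *: 'X^(size t).
    apply: (addIr (fiber_specialize T' (g t'))).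
    by rewrite -fiber_specializeD subrK !fiber_specialize_mon scalerBl size_t subrK.
  apply/eqP/eqP => [/polyP/(_ (size t))|->]; last by rewrite subrr scale0r.
  rewrite coefZ coefXn eqxx mulr1 coef0 => /eqP; rewrite subr_eq0 => /eqP.
  move=> /(congr1 (fun p => p@_(restrict T' (expo u t)))).
  by rewrite !mcoeffX eqxx; case: eqP => [->//|_ /eqP]; rewrite oner_eq0.
move=> /(_ (g t - g t')); rewrite !kernelE => sub.
have /sub/eqP/mnmP/(_ j) : restrict T (expo u t) == restrict T (expo u t').
  apply/eqP/mnmP => i; rewrite !mnmE; case: (boolP (i \in T)) => // iT.
  have /mnmP/(_ i) := rel; rewrite !mnmDE !mnm1E.
  have /negPf-> : j != i by apply: contraNneq jT => ->.
  have /negPf-> : l != i by apply: contraNneq lT => ->.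
  by rewrite /= !add0n => ->.
rewrite !mnmE inE eqxx !mul1n.
by have /mnmP/(_ j) := rel; rewrite !mnmDE !mnm1E eqxx (negPf neq); lia.
Qed.

End FiberSpecialization.

(** * The chain of specialization kernels *)

Section FiberChain.
Variables (K : fieldType) (n : nat) (I : {pred {mpoly K[n]}}).
Local Notation F := (fiber_ring I).
Variables (m : nat) (u : m.-tuple 'X_{1..n}).
Hypotheses (idI : is_ideal I) (monI : monomial_ideal I).
Hypothesis uP : forall v, v \in u <-> min_gen I v.
Variable d : nat.
Hypothesis deg_d : forall w, min_gen I w -> mdeg w = d.

(** The nonroots are dropped one by one; a generator u_a is needed for the last
    step, where its class separates the irrelevant ideal from the kernel of
    F -> K[t]. *)
Lemma fiber_prime_chain_exists (a : 'I_m) :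
  exists P : 'I_(#|nonroot I|.+1).+1 -> {pred F}, prime_chain P.
Proof.
pose js := enum (nonroot I); pose q := #|nonroot I|.
pose P i : {pred F} := if (i <= q)%N then spec_kernel d (drop i js)
                       else irrelevant_ideal d.
have size_js : size js = q by rewrite -cardE.
exists (fun i => P i); apply: prime_chain_steps => i; rewrite /P.
  case: ifP => _; first exact: (spec_kernel_prime idI monI uP deg_d).
  exact: (irrelevant_ideal_prime idI monI uP deg_d).
rewrite ltnS => le_iq; rewrite le_iq; case: ltnP => [lt_iq|le_qi]; last first.
  rewrite drop_oversize ?size_js //; split; first exact: spec_kernel_irrelevant.
  exact: (irrelevant_ideal_strict idI monI uP deg_d a).
have [j0 _] : exists j : 'I_n, j \in js.
  by case: (js) size_js lt_iq => [<-//|j s _ _]; exists j; rewrite inE eqxx.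
rewrite (drop_nth j0) ?size_js //; set j := nth j0 js i.
have js_j : j \in js by rewrite mem_nth ?size_js.
split; first by apply: spec_kernel_sub => k kT; rewrite inE kT orbT.
have root_js k : k \in js -> fingraph.root (linear_relation_graph I) k != k.
  by rewrite mem_enum.
apply: (spec_kernel_strict idI monI uP deg_d (connect_root _ j)).
- exact: root_js.
- apply/negP => /mem_drop/root_js.
  by rewrite root_root ?eqxx //; apply: sym_connect_sym (linear_relation_graph_sym I).
- have : uniq (drop i js) by rewrite drop_uniq ?enum_uniq.
  by rewrite (drop_nth j0) ?size_js // => /andP[].
Qed.

End FiberChain.

Theorem lemma4p3 (K : fieldType) (n : nat) (I : {pred {mpoly K[n]}})
    (hI : is_ideal I)
    (hI0 : exists2 p : {mpoly K[n]}, p \in I & p <> 0%R)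
    (hmon : monomial_ideal I)
    (hdeg : generated_in_single_degree I)
    (hlin : has_linear_relations I)
    (r s : nat)
    (hr : #|graph_vertices (linear_relation_graph I)| = r)
    (hs : n_comp (linear_relation_graph I)
            (graph_vertices (linear_relation_graph I)) = s) :
  has_analytic_spread I (r - s + 1)%N.
Proof.
have [m [u [_ uP lin_u]]] := hlin; have [d [B [homB IE]]] := hdeg.
have deg_d := min_gen_deg hI hmon homB IE.
have -> : (r - s + 1 = #|nonroot I|.+1)%N by rewrite addn1 card_nonroot hr hs.
have [a] : exists a : 'I_m, True.
  have [p Ip /eqP p_neq0] := hI0; have Iv := monomial_ideal_supp hI hmon Ip (mlead_supp p_neq0).
  by have [w /(min_gen_index uP)[a _] _] := min_gen_below Iv; exists a.
split; first exact: (fiber_prime_chain_exists hI hmon uP deg_d).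
exact: (fiber_prime_chain_le hI hmon uP lin_u deg_d).
Qed.
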